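(* In the setting described in the context, for the action of the weak Hopf algebra $A$ on $M$ given by $a\triangleright m=a_{(1)}mS(a_{(2)})$, we have $N=M^A$, where $M^A=\{m\in M: a\triangleright m=\varepsilon_t(a)\triangleright m \text{ for all } a\in A\}$ is the subalgebra of invariants.
   Context: Conventions. $k$ is a field; algebras are unital associative $k$-algebras; summation over repeated indices (finite sums) is understood; $C_X(Y)$ is the centralizer of $Y$ in $X$; Sweedler notation $\Delta(h)=h_{(1)}\otimes h_{(2)}$ is used. Extensions. An algebra extension $M/N$ is Frobenius if there are an $N$-$N$-bimodule map $E:M\to N$ (Frobenius homomorphism) and finite families $\{x_i\},\{y_i\}$ in $M$ (dual bases for $E$) with $E(mx_i)y_i=m=x_iE(y_im)$ for all $m\in M$. It is strongly separable of index $\lambda^{-1}$ if also $E(1)=1$ and $x_iy_i=\lambda^{-1}1$ with $0\neq\lambda\in k$. It is a Markov extension if moreover there is a trace $T:N\to k$ (Markov trace) with $T(1)=1$ such that $T_0:=T\circ E$ is a trace on $M$. It is a symmetric Markov extension if moreover $E(ux)=E(xu)$ for all $x\in M$, $u\in U:=C_M(N)$. A $k$-algebra is Kanzaki separable if it has a separability element that is symmetric (invariant under the flip). Jones tower. $M_1=M\otimes_N M$, $e_1=1\otimes 1$, elements written $me_1m'=m\otimes m'$, product $(me_1m')(ne_1n')=mE(m'n)e_1n'$, unit $x_ie_1y_i$, $M\subset M_1$ via $m\mapsto mx_ie_1y_i$, and $E_M:M_1\to M$, $E_M(me_1m')=\lambda mm'$. $M_1/M$ is again a symmetric Markov extension of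 index $\lambda^{-1}$ with Frobenius homomorphism $E_M$ and Markov trace $T_0$. Iterating for $M_1/M$ gives $M_2=M_1e_2M_1$ and $E_{M_1}:M_2\to M_1$, $E_{M_1}(xe_2y)=\lambda xy$. Put $T_1=T_0\circ E_M$, $T_2=T_1\circ E_{M_1}$ (traces on $M_1$, $M_2$). Centralizers: $U=C_M(N)$, $V=C_{M_1}(M)$, $W=C_{M_2}(M_1)$, $A=C_{M_1}(N)$, $B=C_{M_2}(M)$, $C=C_{M_2}(N)$. $T$ also denotes the restriction of $T_2$ to $C$. Let $\phi:U\to V$, $\phi(u)=x_iue_1y_i$ (an algebra anti-isomorphism). Standing assumptions. (i) $M/N$ is a symmetric Markov extension. (ii) Symmetric product: $x_iy_i=y_ix_i=\lambda^{-1}1$ (alternatively, instead of $y_ix_i=\lambda^{-1}1$ one may assume $T_0|_U=T_1\circ\phi$). (iii) Weak irreducibility: $U$ is a Kanzaki separable $k$-algebra and $T_0|_U$ is a non-degenerate trace. (iv) Depth $2$: $E_M$ has dual bases lying in $A$, and $E_{M_1}$ has dual bases $\{u_j\},\{v_j\}$ lying in $B$. Structure on $A$. $f=f^{(1)}\otimes f^{(2)}$ is the unique symmetric separability element of $V$ and $w=[f^{(1)}T(f^{(2)})]^{-1}\in Z(V)$ (an invertible element of the center of $V$). The bilinear forms $\langle a,b\rangle=\lambda^{-2}T(ae_2e_1wb)$ and $\langle a,b\rangle'=\lambda^{-2}T(be_1e_2wa)$ on $A\times B$ are non-degenerate. Let $S_B:B\to B$ be the linear bijection with $\langle a,b\rangle=\langle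 a,S_B(b)\rangle'$ for all $a\in A$, $b\in B$. $A$ is a weak Hopf algebra with its algebra structure and: comultiplication defined by $\langle a_{(1)},b\rangle\langle a_{(2)},b'\rangle=\langle a,bb'\rangle$ for all $b,b'\in B$; counit $\varepsilon(a)=\langle a,1\rangle$; antipode $S:A\to A$ defined by $\langle S(a),b\rangle=\langle a,S_B(b)\rangle$ for all $b\in B$. Its target counital map is $\varepsilon_t(a)=\varepsilon(1_{(1)}a)1_{(2)}$, where $\Delta(1)=1_{(1)}\otimes1_{(2)}$ in $A\otimes A$. The formula $a\triangleright m=a_{(1)}mS(a_{(2)})$ makes $M$ a left $A$-module algebra (a left $A$-module with $a\triangleright(mm')=(a_{(1)}\triangleright m)(a_{(2)}\triangleright m')$ and $a\triangleright1=\varepsilon_t(a)\triangleright1$). *)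

(* Defs.v *)
From HB Require Import structures.
From mathcomp Require Import all_boot all_order all_algebra.
From mathcomp Require Import boolp classical_sets.

Set Implicit Arguments.
Unset Strict Implicit.
Unset Printing Implicit Defensive.

Import GRing.Theory.
Local Open Scope ring_scope.

(** An algebra extension M/N is a unital algebra morphism [i : N -> M].  It is
    automatically injective once [i] has a left inverse [E] as below, so N is
    then identified with [range i]. *)

Definition centralizer (k : fieldType) (N M : algType k) (i : N -> M) :
    {pred M} :=
  fun x => `[< forall n : N, i n * x = x * i n >].

Lemma centralizer_subalg (k : fieldType) (N M : algType k) (i : N -> M) :
  GRing.subsemialg_closed (centralizer i).
Proof.
split.
- by apply/asboolP => n; rewrite mulr1 mul1r.
- split=> [|x y /asboolP hx /asboolP hy].
    by apply/asboolP => n; rewrite mulr0 mul0r.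
  by apply/asboolP => n; rewrite mulrDr mulrDl hx hy.
- by move=> c x /asboolP hx; apply/asboolP => n; rewrite -scalerAr hx scalerAl.
- move=> x y /asboolP hx /asboolP hy; apply/asboolP => n.
  by rewrite mulrA hx -mulrA hy mulrA.
Qed.

HB.instance Definition _ (k : fieldType) (N M : algType k) (i : N -> M) :=
  GRing.isSubalgClosed.Build k M (centralizer i) (centralizer_subalg i).

(** [centr i] is the algebra C_M(N). *)
Record centr (k : fieldType) (N M : algType k) (i : N -> M) := Centr {
  centr_val : M;
  centr_valP : centr_val \in centralizer i
}.

HB.instance Definition _ (k : fieldType) (N M : algType k) (i : N -> M) :=
  [isSub for @centr_val k N M i].
HB.instance Definition _ (k : fieldType) (N M : algType k) (i : N -> M) :=
  [Choice of centr i by <:].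
HB.instance Definition _ (k : fieldType) (N M : algType k) (i : N -> M) :=
  [SubChoice_isSubAlgebra of centr i by <:].

Definition is_trace (k : fieldType) (A : algType k) (t : A -> k) : Prop :=
  forall a b : A, t (a * b) = t (b * a).

Section TensorProduct.
Variables (k : fieldType) (N M : algType k) (i : N -> M).

Record balanced (G : zmodType) (b : M -> M -> G) : Prop := {
  balancedDl : forall m1 m2 m', b (m1 + m2) m' = b m1 m' + b m2 m';
  balancedDr : forall m m1 m2, b m (m1 + m2) = b m m1 + b m m2;
  balancedM : forall m n m', b (m * i n) m' = b m (i n * m')
}.

(** [t] exhibits [P] as M (x)_N M, with [t m m'] the tensor m (x) m'. *)
Record is_tensor_product (P : zmodType) (t : M -> M -> P) : Prop := {
  tensor_balanced : balanced t;
  tensor_lift : forall (G : zmodType) (b : M -> M -> G), balanced b ->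
    exists g : {additive P -> G}, forall m m', g (t m m') = b m m';
  tensor_ext : forall (G : zmodType) (g h : {additive P -> G}),
    (forall m m', g (t m m') = h (t m m')) -> g =1 h
}.

End TensorProduct.

(** The list [:: (a_1, b_1); ...; (a_n, b_n)] stands for the element
    sum_i a_i (x) b_i of A (x)_k A; by the universal property, two lists denote
    the same tensor iff they have the same image under every bilinear map. *)
Definition tensor_eq (k : fieldType) (A : algType k) (s t : seq (A * A)) : Prop :=
  forall (G : lmodType k) (b : {bilinear A -> A -> G}),
    \sum_(p <- s) b p.1 p.2 = \sum_(p <- t) b p.1 p.2.

Record symmetric_separability_element (k : fieldType) (A : algType k)
    (s : seq (A * A)) : Prop := {
  sep_mul : \sum_(p <- s) p.1 * p.2 = 1;
  sep_comm : forall a : A, tensor_eq [seq (a * p.1, p.2) | p <- s]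
                                     [seq (p.1, p.2 * a) | p <- s];
  sep_flip : tensor_eq [seq (p.2, p.1) | p <- s] s
}.

Definition kanzaki_separable (k : fieldType) (A : algType k) : Prop :=
  exists s : seq (A * A), symmetric_separability_element s.

Section Extensions.
Variables (k : fieldType) (N M : algType k).
Variables (i : {lrmorphism N -> M}) (E : {linear M -> N}).

Definition dual_bases (r : nat) (x y : 'I_r -> M) : Prop :=
  forall m : M, \sum_l i (E (m * x l)) * y l = m
             /\ \sum_l x l * i (E (y l * m)) = m.

Record symmetric_markov (r : nat) (x y : 'I_r -> M) (lambda : k)
    (T : {scalar N}) : Prop := {
  frobenius_bimodule : forall n m n', E (i n * m * i n') = n * E m * n';
  frobenius_dual_bases : dual_bases x y;
  strong_E1 : E 1 = 1;
  strong_lambda : lambda != 0;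
  strong_index : \sum_l x l * y l = lambda^-1 *: 1;
  markov_trace : is_trace T;
  markov_normalized : T 1 = 1;
  markov_trace0 : is_trace (fun m => T (E m));
  markov_symmetric : forall (u : centr i) (m : M), E (val u * m) = E (m * val u)
}.

(** [M1] is the basic construction M (x)_N M = M e1 M, [j] is the inclusion of
    M and [EM] is E_M.  Since [j] is multiplicative, [basic_unit] gives
    j m = sum_l (m x_l) e1 y_l. *)
Record basic_construction (lambda : k) (M1 : algType k)
    (j : {lrmorphism M -> M1}) (e1 : M1) (EM : {linear M1 -> M}) : Prop := {
  basic_tensor : is_tensor_product i (fun m m' => j m * e1 * j m');
  basic_mul : forall m m' n n',
    (j m * e1 * j m') * (j n * e1 * j n') = j (m * i (E (m' * n))) * e1 * j n';
  basic_unit : forall (r : nat) (x y : 'I_r -> M), dual_bases x y ->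
    \sum_l j (x l) * e1 * j (y l) = 1;
  basic_EM : forall m m', EM (j m * e1 * j m') = lambda *: (m * m')
}.

End Extensions.

Section Tower.
Variables (k : fieldType) (N M M1 M2 : algType k).
Variables (i : {lrmorphism N -> M}) (E : {linear M -> N}) (T : {scalar N}).
Variables (lambda : k) (r : nat) (x y : 'I_r -> M).
Variables (j1 : {lrmorphism M -> M1}) (e1 : M1) (EM : {linear M1 -> M}).
Variables (j2 : {lrmorphism M1 -> M2}) (e2 : M2) (EM1 : {linear M2 -> M1}).

Definition trace0 (m : M) : k := T (E m).
Definition trace1 (z : M1) : k := trace0 (EM z).
Definition trace2 (z : M2) : k := trace1 (EM1 z).

Local Notation U := (centr i).
Local Notation V := (centr j1).
Local Notation A := (centr (j1 \o i)).
Local Notation B := (centr (j2 \o j1)).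

Definition phi (u : U) : M1 := \sum_l j1 (x l * val u) * e1 * j1 (y l).

Definition symmetric_product : Prop :=
  \sum_l y l * x l = lambda^-1 *: 1 \/ forall u : U, trace0 (val u) = trace1 (phi u).

Definition weakly_irreducible : Prop :=
  kanzaki_separable U /\
  forall u : U, (forall u' : U, trace0 (val u * val u') = 0) -> u = 0.

Definition depth2 : Prop :=
  (exists (s : nat) (p q : 'I_s -> A), dual_bases j1 EM (fun l => val (p l)) (fun l => val (q l))) /\
  (exists (s : nat) (u v : 'I_s -> B), dual_bases j2 EM1 (fun l => val (u l)) (fun l => val (v l))).

Definition pairing (w : V) (a : A) (b : B) : k :=
  lambda ^- 2 * trace2 (j2 (val a) * e2 * j2 e1 * j2 (val w) * val b).

Definition pairing' (w : V) (a : A) (b : B) : k :=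
  lambda ^- 2 * trace2 (val b * j2 e1 * e2 * j2 (val w) * j2 (val a)).

(** [Delta a] is a list of pairs representing the tensor Delta(a) in
    A (x)_k A, see [tensor_eq]. *)
Record weak_hopf_structure (f : seq (V * V)) (w : V) (SB : {linear B -> B})
    (Delta : A -> seq (A * A)) (S : A -> A) : Prop := {
  wh_f : symmetric_separability_element f;
  wh_wl : w * (\sum_(p <- f) trace2 (j2 (val p.2)) *: p.1) = 1;
  wh_wr : (\sum_(p <- f) trace2 (j2 (val p.2)) *: p.1) * w = 1;
  wh_SB_bij : bijective SB;
  wh_SB : forall a b, pairing w a b = pairing' w a (SB b);
  wh_Delta : forall (a : A) (b b' : B),
    \sum_(p <- Delta a) pairing w p.1 b * pairing w p.2 b' = pairing w a (b * b');
  wh_S : forall (a : A) (b : B), pairing w (S a) b = pairing w a (SB b)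
}.

Definition counit (w : V) (a : A) : k := pairing w a 1.

Definition target_counit (w : V) (Delta : A -> seq (A * A)) (a : A) : A :=
  \sum_(p <- Delta 1) counit w (p.1 * a) *: p.2.

(** a |> m, as an element of M1, into which M embeds through [j1]. *)
Definition act (Delta : A -> seq (A * A)) (S : A -> A) (a : A) (m : M) : M1 :=
  \sum_(p <- Delta a) val p.1 * j1 m * val (S p.2).

Definition invariants (w : V) (Delta : A -> seq (A * A)) (S : A -> A) : set M :=
  [set m | forall a : A,
     act Delta S a m = act Delta S (target_counit w Delta a) m]%classic.

End Tower.

Arguments weak_hopf_structure {k N M M1 M2} i E T lambda j1 e1 EM j2 e2 EM1.
Arguments invariants {k N M M1 M2} i E T lambda j1 e1 EM j2 e2 EM1.

(* Main.v *)
Require Import Defs.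
From HB Require Import structures.
From mathcomp Require Import all_boot all_order all_algebra.
From mathcomp Require Import boolp classical_sets.

Set Implicit Arguments.
Unset Strict Implicit.
Unset Printing Implicit Defensive.

Import GRing.Theory.
Local Open Scope ring_scope.

(** Why the theorem holds.  The algebra M1 acts on M by the natural action
    z . m = lambda^-1 E_M (z m e1), which identifies it with End(M_N).  The key
    claim is that the Hopf-theoretic action is this one:
    a_(1) m S(a_(2)) = a . m  ([act_natural]), and that the target counital map
    is a |-> a . 1  ([target_counit_natural]).  Since a . 1 lies in M and acts
    by left multiplication, m is invariant iff a . m = (a . 1) m for all a.
    Elements of N satisfy this because the natural action is right N-linear.
    Conversely e1 . m = E m and e1 . 1 = 1, so taking a = e1 gives m = E m.

    To prove the claim (sums over repeated indices are understood), the map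
    b |-> z_b = lambda^-1 E_M1 (e2 e1 w b) is shown to send B onto A, and
    <a, b> = lambda^-1 T1 (a z_b).  This turns every definition through the
    pairing into a statement about the trace form T1 on A.  There
    - the natural action of M2 on M1 satisfies S_B(b) . e1 = z_b w^-1
      ([lact_SB]), so the coproduct and the antipode combine into
        T1 (a_(1) c) T1 (S(a_(2)) z) = lambda T1 (X c) for c, z in A,
        where X = (a . x_l) z w^-1 y_l            ([coproduct_antipode]);
    - T1 has on A dual bases P_t, Q_t with
        lambda P_t w^-1 m Q_t = E m for m in M   ([T1_dual_A]).
    Expanding a_(1) and S(a_(2)) in these dual bases,
      a_(1) m S(a_(2)) = lambda (a . x_l) P_t w^-1 y_l m Q_t
                       = (a . x_l) E (y_l m) = a . m.

    The dual bases of A come from those of B, through the two bijections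
    b |-> b . e1 and b |-> lambda^-1 E_M1 (e2 e1 b) from B to A, which turn the
    trace form of B into that of A up to the factor lambda
    ([T1_lact_ract]).  The dual bases of B are those of E_M1 combined with
    those of T1 on V, and the latter are f^(2), w f^(1): this is how w, the
    inverse of f^(1) T(f^(2)), enters. *)

Lemma centralizerP (k : fieldType) (N M : algType k) (i : N -> M) (m : M) :
  reflect (forall n, i n * m = m * i n) (m \in centralizer i).
Proof. exact: asboolP. Qed.

Lemma centrC (k : fieldType) (N M : algType k) (i : N -> M) (u : centr i) n :
  i n * val u = val u * i n.
Proof. exact/centralizerP/(centr_valP u). Qed.

(** * One step of the Jones tower *)

Section BasicConstruction.
Variables (k : fieldType) (N M M1 : algType k).
Variables (i : {lrmorphism N -> M}) (E : {linear M -> N}).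
Variables (r : nat) (x y : 'I_r -> M) (lambda : k).
Variables (j : {lrmorphism M -> M1}) (e : M1) (EM : {linear M1 -> M}).
Hypothesis dual_xy : dual_bases i E x y.
Hypothesis lambda0 : lambda != 0.
Hypothesis basicM1 : basic_construction i E lambda j e EM.

(** The left action of M1 on M, under which M1 is End(M_N), and its mirror
    image, the right action of M1 on M. *)
Definition lact (z : M1) (m : M) : M := lambda^-1 *: EM (z * j m * e).
Definition ract (z : M1) (m : M) : M := lambda^-1 *: EM (e * j m * z).

Lemma jones_comm n : j (i n) * e = e * j (i n).
Proof.
have := balancedM (tensor_balanced (basic_tensor basicM1)) 1 n 1.
by rewrite mul1r mulr1 rmorph1 mulr1 mul1r.
Qed.

Lemma jones_sandwich m : e * j m * e = j (i (E m)) * e.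
Proof.
have := basic_mul basicM1 1 m 1 1.
by rewrite !rmorph1 !mul1r !mulr1.
Qed.

Lemma EM_gen m m' : EM (j m * e * j m') = lambda *: (m * m').
Proof. exact: basic_EM basicM1 m m'. Qed.

Lemma EM_e m : EM (j m * e) = lambda *: m.
Proof. by have := EM_gen m 1; rewrite rmorph1 !mulr1. Qed.

Lemma lact_gen m m' n : lact (j m * e * j m') n = m * i (E (m' * n)).
Proof.
rewrite /lact -!mulrA (mulrA (j m')) -rmorphM (mulrA e) jones_sandwich.
by rewrite mulrA -rmorphM EM_e scalerA mulVf // scale1r.
Qed.

(** Both sides are additive in z, so it is enough to compare them on the
    generators m e m'.  This makes every later identity about M1 a computation
    with an explicit finite sum. *)
Lemma basic_expand z : z = \sum_l j (lact z (x l)) * e * j (y l).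
Proof.
pose h u := \sum_l j (lact u (x l)) * e * j (y l).
have hB : zmod_morphism h.
  move=> u v; rewrite /h -sumrB; apply: eq_bigr => l _.
  by rewrite /lact !(mulrBl, raddfB, scalerBr).
pose hA : {additive M1 -> M1} :=
  HB.pack h (GRing.isZmodMorphism.Build _ _ h hB).
pose idA : {additive M1 -> M1} := idfun.
apply: (tensor_ext (basic_tensor basicM1) (g := idA) (h := hA)) => m m'.
rewrite /= /h.
under eq_bigr => l _ do
  rewrite lact_gen rmorphM -(mulrA (j m)) jones_comm -!mulrA -rmorphM.
by rewrite -!mulr_sumr -rmorph_sum (dual_xy m').1 mulrA.
Qed.

Lemma EM_expand z : EM z = lambda *: \sum_l lact z (x l) * y l.
Proof.
rewrite {1}[z]basic_expand raddf_sum scaler_sumr.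
by apply: eq_bigr => l _; rewrite /= EM_gen.
Qed.

Lemma EM_l m z : EM (j m * z) = m * EM z.
Proof.
rewrite {1}[z]basic_expand mulr_sumr raddf_sum /= EM_expand -scalerAr mulr_sumr.
rewrite scaler_sumr; apply: eq_bigr => l _.
by rewrite !mulrA -rmorphM EM_gen.
Qed.

Lemma EM_r m z : EM (z * j m) = EM z * m.
Proof.
rewrite {1}[z]basic_expand mulr_suml raddf_sum /= EM_expand -scalerAl mulr_suml.
rewrite scaler_sumr; apply: eq_bigr => l _.
by rewrite -!mulrA -rmorphM mulrA EM_gen mulrA.
Qed.

(** The left ideal M1 e is M e: on it, an element of M1 may be replaced by the
    element of M through which it acts. *)
Lemma lactE z m : z * j m * e = j (lact z m) * e.
Proof.
have H : z * j m * e = j (\sum_l lact z (x l) * i (E (y l * m))) * e.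
  rewrite {1}[z]basic_expand !mulr_suml rmorph_sum mulr_suml.
  apply: eq_bigr => l _; rewrite -!mulrA (mulrA (j (y l))) -rmorphM (mulrA e).
  by rewrite jones_sandwich mulrA -rmorphM.
by rewrite H {2}/lact H EM_e scalerA mulVf // scale1r.
Qed.

Lemma ractE z m : e * j m * z = e * j (ract z m).
Proof.
have H : e * j m * z = e * j (\sum_l i (E (m * lact z (x l))) * y l).
  rewrite {1}[z]basic_expand mulr_sumr rmorph_sum mulr_sumr.
  apply: eq_bigr => l _; rewrite -!mulrA (mulrA (j m)) -rmorphM.
  by rewrite mulrA (mulrA (e * _)) jones_sandwich jones_comm -!mulrA -rmorphM.
have EMe n : EM (e * j n) = lambda *: n.
  by have := EM_gen 1 n; rewrite rmorph1 !mul1r.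
by rewrite H /ract H EMe scalerA mulVf // scale1r.
Qed.

Lemma jones_inj m m' : j m * e = j m' * e -> m = m'.
Proof.
move=> h; have := congr1 (fun z => lambda^-1 *: EM z) h.
by rewrite !EM_e !scalerA mulVf // !scale1r.
Qed.

Lemma lact_l n z m : (forall n, j (i n) * z = z * j (i n)) ->
  lact z (i n * m) = i n * lact z m.
Proof.
by move=> cz; rewrite /lact rmorphM mulrA -cz -!mulrA EM_l scalerAr.
Qed.

Lemma lact_r n z m : lact z (m * i n) = lact z m * i n.
Proof.
by rewrite /lact rmorphM -!mulrA jones_comm !mulrA EM_r scalerAl.
Qed.

Lemma ract_l z n m : ract z (i n * m) = i n * ract z m.
Proof. by rewrite /ract rmorphM !mulrA -jones_comm -!mulrA EM_l scalerAr. Qed.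

Lemma lact_mulj z m m' : lact (z * j m) m' = lact z (m * m').
Proof. by rewrite /lact rmorphM !mulrA. Qed.

Lemma lact_jmul z m m' : lact (j m * z) m' = m * lact z m'.
Proof. by rewrite /lact -!mulrA EM_l scalerAr. Qed.

Lemma ract_mulj z m m' : ract (z * j m) m' = ract z m' * m.
Proof. by rewrite /ract mulrA EM_r scalerAl. Qed.

Lemma ract_jmul z m m' : ract (j m * z) m' = ract z (m' * m).
Proof. by rewrite /ract rmorphM !mulrA. Qed.

Lemma ract_gen m m' n : ract (j m * e * j m') n = i (E (n * m)) * m'.
Proof.
rewrite /ract !mulrA -(mulrA e) -rmorphM jones_sandwich.
by rewrite EM_gen scalerA mulVf // scale1r.
Qed.

Lemma lactZ c z m : lact (c *: z) m = c *: lact z m.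
Proof. by rewrite /lact -!scalerAl linearZ /= scalerA mulrC -scalerA. Qed.

Lemma lact_sum I (s : seq I) (F : I -> M1) m :
  lact (\sum_(l <- s) F l) m = \sum_(l <- s) lact (F l) m.
Proof. by rewrite /lact !mulr_suml raddf_sum scaler_sumr. Qed.

Lemma lact_sumr I (s : seq I) (F : I -> M) z :
  lact z (\sum_(l <- s) F l) = \sum_(l <- s) lact z (F l).
Proof.
by rewrite /lact raddf_sum mulr_sumr mulr_suml raddf_sum scaler_sumr.
Qed.

Lemma lact_unit m : lact 1 m = m.
Proof. by rewrite /lact mul1r EM_e scalerA mulVf // scale1r. Qed.

Lemma ract_unit m : ract 1 m = m.
Proof.
rewrite /ract mulr1 -[e]mul1r -(rmorph1 j) EM_gen mul1r scalerA mulVf //.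
exact: scale1r.
Qed.

Lemma lact_e m : lact e m = i (E m).
Proof.
by rewrite /lact jones_sandwich EM_e scalerA mulVf // scale1r.
Qed.

Lemma ractZ c z m : ract (c *: z) m = c *: ract z m.
Proof. by rewrite /ract -!scalerAr linearZ /= scalerA mulrC -scalerA. Qed.

Lemma ract_sum I (s : seq I) (F : I -> M1) m :
  ract (\sum_(l <- s) F l) m = \sum_(l <- s) ract (F l) m.
Proof. by rewrite /ract !mulr_sumr raddf_sum scaler_sumr. Qed.

(** The tensor x_l (x) y_l over N satisfies m x_l (x) y_l = x_l (x) y_l m. *)
Lemma casimir_central (P : algType k) (h : {lrmorphism M -> P}) (G : P) m :
  (forall n, h (i n) * G = G * h (i n)) ->
  h m * (\sum_l h (x l) * G * h (y l)) = (\sum_l h (x l) * G * h (y l)) * h m.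
Proof.
move=> cG; rewrite mulr_sumr mulr_suml.
transitivity (\sum_l \sum_l' h (x l') * G * h (i (E (y l' * m * x l)) * y l)).
  apply: eq_bigr => l _; rewrite !mulrA -rmorphM -{1}(dual_xy (m * x l)).2.
  rewrite rmorph_sum !mulr_suml; apply: eq_bigr => l' _.
  by rewrite !rmorphM -!mulrA (mulrA G) -cG !mulrA.
rewrite exchange_big; apply: eq_bigr => l' _ /=.
by rewrite -mulr_sumr -rmorph_sum (dual_xy _).1 rmorphM !mulrA.
Qed.

(** The next step of the tower has dual bases too, so that everything in this
    section applies to it. *)
Lemma EM_dual : dual_bases j EM
  (fun l => lambda^-1 *: (j (x l) * e)) (fun l => e * j (y l)).
Proof.
move=> z; split; last first.
  transitivity (z * 1); last by rewrite mulr1.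
  rewrite mulr1 -[RHS](mul1r z) -(basic_unit basicM1 dual_xy) mulr_suml.
  apply: eq_bigr => l _; transitivity (j (x l) * (e * j (ract z (y l)))).
    by rewrite /ract linearZ /= -!scalerAr -scalerAl mulrA.
  by rewrite -ractE !mulrA.
rewrite [RHS]basic_expand; apply: eq_bigr => l _.
by rewrite /lact -scalerAr [EM _]linearZ /= !mulrA.
Qed.

Hypothesis E1 : E 1 = 1.

Lemma jones_idem : e * e = e.
Proof. by have := jones_sandwich 1; rewrite E1 !rmorph1 mulr1 mul1r. Qed.

Lemma EM_dual_index :
  \sum_l (lambda^-1 *: (j (x l) * e)) * (e * j (y l)) = lambda^-1 *: 1.
Proof.
rewrite -(basic_unit basicM1 dual_xy) scaler_sumr; apply: eq_bigr => l _.
by rewrite -scalerAl -!mulrA (mulrA e) jones_idem.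
Qed.

Lemma EM_section m : \sum_l x l * y l = lambda^-1 *: 1 -> EM (j m) = m.
Proof.
move=> index; rewrite -[j m]mulr1 EM_l -(basic_unit basicM1 dual_xy) raddf_sum.
under eq_bigr => l _ do rewrite /= EM_gen.
by rewrite -scaler_sumr index scalerA mulfV // scale1r mulr1.
Qed.

(** On generators, T (E (EM (m e m' * n e n'))) is
    lambda T (E (n' m) E (m' n)), which is symmetric since T is a trace. *)
Lemma EM_trace (T : {scalar N}) :
  (forall m n, E (m * i n) = E m * n) ->
  is_trace T -> is_trace (fun m => T (E m)) ->
  is_trace (fun z => T (E (EM z))).
Proof.
move=> E_r T_tr TE_tr.
have gen m m' n n' : T (E (EM (j m * e * j m' * (j n * e * j n')))) =
    lambda * T (E (n' * m) * E (m' * n)).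
  rewrite (basic_mul basicM1) EM_gen !linearZ /=; congr (_ * _).
  by rewrite TE_tr mulrA E_r.
move=> a b; rewrite [a]basic_expand [b]basic_expand !mulr_suml.
under eq_bigr => l _ do rewrite mulr_sumr.
under [in RHS]eq_bigr => l _ do rewrite mulr_sumr.
rewrite exchange_big /= !raddf_sum /=; apply: eq_bigr => l _.
rewrite !raddf_sum /=; apply: eq_bigr => l' _.
by rewrite !gen T_tr.
Qed.

End BasicConstruction.

(** * Equal tensors *)

Lemma tensor_eq_sum (k : fieldType) (A : algType k) (s t : seq (A * A))
    (G : lmodType k) (F : A -> A -> G) :
  (forall a, linear (F a)) -> (forall b, linear (F^~ b)) -> tensor_eq s t ->
  \sum_(p <- s) F p.1 p.2 = \sum_(p <- t) F p.1 p.2.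
Proof.
move=> Fr Fl st.
pose F2 : {bilinear A -> A -> G} :=
  HB.pack F (bilinear_isBilinear.Build _ _ _ _ _ _ F (conj Fl Fr)).
exact: (st G F2).
Qed.

Lemma tensor_eq_scale (k : fieldType) (A : algType k) (s t : seq (A * A))
    (L : {scalar A}) :
  tensor_eq s t ->
  \sum_(p <- s) L p.1 *: p.2 = \sum_(p <- t) L p.1 *: p.2.
Proof.
apply: (tensor_eq_sum (F := fun a b => L a *: b)) => [a c b b'|b c a a'].
  by rewrite scalerDr scalerA mulrC -scalerA.
by rewrite linearP scalerDl scalerA.
Qed.

(** * The tower N, M, M1, M2 *)

Section JonesTower.
Variables (k : fieldType) (N M M1 M2 : algType k)
  (i : {lrmorphism N -> M}) (E : {linear M -> N}) (T : {scalar N})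
  (lambda : k) (r : nat) (x y : 'I_r -> M)
  (j1 : {lrmorphism M -> M1}) (e1 : M1) (EM : {linear M1 -> M})
  (j2 : {lrmorphism M1 -> M2}) (e2 : M2) (EM1 : {linear M2 -> M1}).
Hypotheses (hMarkov : symmetric_markov i E x y lambda T)
  (hM1 : basic_construction i E lambda j1 e1 EM)
  (hM2 : basic_construction j1 EM lambda j2 e2 EM1)
  (hSym : symmetric_product i E T lambda x y j1 e1 EM).

Local Notation T0 := (trace0 E T).
Local Notation T1 := (trace1 E T EM).
Local Notation T2 := (trace2 E T EM EM1).
Local Notation V := (centr j1).
Local Notation A := (centr (j1 \o i)).
Local Notation B := (centr (j2 \o j1)).
Local Notation inV := (centralizer j1).
Local Notation inA := (centralizer (j1 \o i)).
Local Notation inB := (centralizer (j2 \o j1)).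
Local Notation lact1 := (lact lambda j1 e1 EM).
Local Notation lact2 := (lact lambda j2 e2 EM1).
Local Notation ract2 := (ract lambda j2 e2 EM1).

Let dual0 : dual_bases i E x y := frobenius_dual_bases hMarkov.
Let l0 : lambda != 0 := strong_lambda hMarkov.
Let dual1 := EM_dual dual0 l0 hM1.
Let e1C := jones_comm hM1.
Let e2C := jones_comm hM2.

Lemma EM_j1 m : EM (j1 m) = m.
Proof. exact: (EM_section dual0 l0 hM1 m (strong_index hMarkov)). Qed.

Lemma EM1_j2 z : EM1 (j2 z) = z.
Proof.
apply: (EM_section dual1 l0 hM2).
exact: (EM_dual_index dual0 hM1 (strong_E1 hMarkov)).
Qed.

Lemma E_r m n : E (m * i n) = E m * n.
Proof.
by have := frobenius_bimodule hMarkov 1 m n; rewrite rmorph1 !mul1r.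
Qed.

Lemma T0_trace : is_trace T0.
Proof. exact: markov_trace0 hMarkov. Qed.

Lemma T1_trace : is_trace T1.
Proof.
apply: (EM_trace dual0 l0 hM1 E_r (markov_trace hMarkov)).
exact: markov_trace0 hMarkov.
Qed.

Lemma T2_trace : is_trace T2.
Proof.
pose T0' : {scalar M} := T \o E.
have EMr z m : EM (z * j1 m) = EM z * m by apply: (EM_r dual0 l0 hM1).
exact: (EM_trace (T := T0') dual1 l0 hM2 EMr T0_trace T1_trace).
Qed.

Lemma T0Z c m : T0 (c *: m) = c * T0 m.
Proof. by rewrite /trace0 !linearZ. Qed.

Lemma T1Z c z : T1 (c *: z) = c * T1 z.
Proof. by rewrite /trace1 /trace0 !linearZ. Qed.

Lemma T1_sum I (s : seq I) (F : I -> M1) :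
  T1 (\sum_(l <- s) F l) = \sum_(l <- s) T1 (F l).
Proof. by rewrite /trace1 /trace0 !raddf_sum. Qed.

Lemma T2_j2l z b : T2 (j2 z * b) = T1 (z * EM1 b).
Proof. by rewrite /trace2 (EM_l dual1 l0 hM2). Qed.

Lemma T2_j2r z b : T2 (b * j2 z) = T1 (EM1 b * z).
Proof. by rewrite /trace2 (EM_r dual1 l0 hM2). Qed.

Lemma T2_j2 z : T2 (j2 z) = T1 z.
Proof. by rewrite /trace2 EM1_j2. Qed.

Lemma e1_in : e1 \in inA.
Proof. by apply/centralizerP => n; apply: e1C. Qed.

Lemma V_sub_A v : v \in inV -> v \in inA.
Proof. by move=> /centralizerP cv; apply/centralizerP => n; apply: cv. Qed.

Lemma j2V_in v : v \in inV -> j2 v \in inB.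
Proof.
move=> /centralizerP cv; apply/centralizerP => m /=.
by rewrite -!rmorphM cv.
Qed.

Lemma EM1_B_in b : b \in inB -> EM1 b \in inV.
Proof.
move=> /centralizerP cb; apply/centralizerP => m.
by rewrite -(EM_l dual1 l0 hM2) cb (EM_r dual1 l0 hM2).
Qed.

Lemma lact2_in b a : b \in inB -> a \in inA -> lact2 b a \in inA.
Proof.
move=> /centralizerP cb /centralizerP ca; apply/centralizerP => n /=.
rewrite -(lact_jmul dual1 l0 hM2) [j2 _ * b]cb lact_mulj [j1 _ * a]ca.
by rewrite (lact_r dual1 l0 hM2).
Qed.

Lemma ract2_in b a : b \in inB -> a \in inA -> ract2 b a \in inA.
Proof.
move=> /centralizerP cb /centralizerP ca; apply/centralizerP => n /=.
rewrite -(ract_mulj dual1 l0 hM2) -[b * _]cb ract_jmul -[a * _]ca.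
by rewrite (ract_l dual1 l0 hM2).
Qed.

(** The bimodule endomorphism m e1 m' |-> m a m' of M1 is well defined because
    a commutes with N; the witness is the element of M2 that acts by it. *)
Lemma lact2_surj a : a \in inA -> exists2 b, b \in inB & lact2 b e1 = a.
Proof.
move=> /centralizerP ca.
exists (lambda^-1 *:
    \sum_l (j2 \o j1) (x l) * (j2 a * e2 * j2 e1) * (j2 \o j1) (y l)).
  apply: rpredZ; apply/centralizerP => m.
  apply: (casimir_central dual0 (h := j2 \o j1)) => n /=.
  by rewrite !mulrA -rmorphM [j1 _ * a]ca rmorphM -!mulrA (mulrA _ e2) e2C
    -!mulrA -!rmorphM e1C.
rewrite lactZ lact_sum -[RHS]mul1r -[in RHS](rmorph1 j1) -(dual0 1).2.
rewrite rmorph_sum mulr_suml scaler_sumr; apply: eq_bigr => l _ /=.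
rewrite !mulrA -rmorphM -(mulrA (_ * e2)) -rmorphM (lact_gen l0 hM2).
rewrite (jones_sandwich hM1) (EM_e hM1) linearZ /= -scalerAr scalerA mulVf //.
by rewrite scale1r mulr1 rmorphM -!mulrA [j1 (i _) * a]ca.
Qed.

Lemma ract2_surj a : a \in inA -> exists2 b, b \in inB & ract2 b e1 = a.
Proof.
move=> /centralizerP ca.
exists (lambda^-1 *:
    \sum_l (j2 \o j1) (x l) * (j2 e1 * e2 * j2 a) * (j2 \o j1) (y l)).
  apply: rpredZ; apply/centralizerP => m.
  apply: (casimir_central dual0 (h := j2 \o j1)) => n /=.
  by rewrite !mulrA -rmorphM e1C rmorphM -!mulrA (mulrA _ e2) e2C
    -!mulrA -!rmorphM [j1 _ * a]ca.
rewrite ractZ ract_sum -[RHS]mulr1 -[in RHS](rmorph1 j1) -(dual0 1).1.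
rewrite rmorph_sum mulr_sumr scaler_sumr; apply: eq_bigr => l _ /=.
rewrite !mulrA -rmorphM -(mulrA (_ * e2)) -rmorphM (ract_gen l0 hM2).
rewrite (mulrA e1) (jones_sandwich hM1) (EM_e hM1) linearZ /= -scalerAl.
by rewrite scalerA mulVf // scale1r mul1r rmorphM !mulrA [j1 _ * a]ca.
Qed.

(** An element v of V is phi u for u = v . 1, and v e1 = u e1; hence
    T1 (e1 v) = lambda T0 u, and T0 u = T1 (phi u) by the symmetry of the
    product x_l y_l. *)
Lemma T1_jones_V v : v \in inV -> T1 (e1 * v) = lambda * T1 v.
Proof.
move=> vV; have /centralizerP cv := vV.
have uU : lact1 v 1 \in centralizer i.
  apply/centralizerP => n; rewrite -(lact_r dual0 l0 hM1) mul1r.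
  by rewrite -(lact_l dual0 l0 hM1) ?mulr1.
pose u : centr i := Centr uU.
have v_phi : v = phi x y j1 e1 u.
  rewrite {1}(basic_expand dual0 l0 hM1 v) /phi; apply: eq_bigr => l _.
  by rewrite /= -(lact_jmul dual0 l0 hM1) cv lact_mulj mulr1.
have T_phi : T1 (phi x y j1 e1 u) = T0 (val u).
  case: hSym => [yx|-> //].
  rewrite /phi T1_sum.
  under eq_bigr => l _ do
    rewrite /trace1 (EM_gen hM1) T0Z -mulrA T0_trace -mulrA.
  rewrite -mulr_sumr -[RHS]mul1r -(mulfV l0) -mulrA -T0Z; congr (_ * _).
  rewrite -[in RHS](mulr1 (val u)) scalerAr -yx /trace0 mulr_sumr !raddf_sum.
  by [].
rewrite T1_trace {1}/trace1 -{1}[v]mulr1 -(rmorph1 j1) (lactE dual0 l0 hM1).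
by rewrite (EM_e hM1) T0Z {2}v_phi T_phi.
Qed.

(** In M2, the unit is lambda^-1 x_l e1 e2 e1 y_l.  Multiplying it by e1 on the
    left turns e1 x_l e1 into E (x_l) e1, which moves through to y_l. *)
Lemma jones_braid : j2 e1 * e2 * j2 e1 = lambda *: j2 e1.
Proof.
set J := _ * _ * _; have JC n : j2 (j1 (i n)) * J = J * j2 (j1 (i n)).
  by rewrite /J !mulrA -rmorphM e1C rmorphM -!mulrA (mulrA _ e2) e2C
    -!mulrA -!rmorphM e1C.
have H : j2 e1 = lambda^-1 *: (J * j2 (j1 (\sum_l i (E (1 * x l)) * y l))).
  rewrite -{1}[j2 e1]mulr1 -(basic_unit hM2 dual1) !rmorph_sum !mulr_sumr.
  rewrite scaler_sumr; apply: eq_bigr => l _ /=.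
  rewrite mul1r linearZ /= -!scalerAl -scalerAr !rmorphM !(mulrA J) -JC /J.
  by rewrite !mulrA -!rmorphM (jones_sandwich hM1).
by rewrite H (dual0 1).1 !rmorph1 mulr1 scalerA mulfV // scale1r.
Qed.

(** The product of b e1 e2 and e2 e1 b' is lambda b e1 b', and the trace of
    e1 b' b is lambda times that of b' b because E_M1 maps B to V. *)
Lemma T1_lact_ract b b' : b \in inB -> b' \in inB ->
  T1 (lact2 b e1 * ract2 b' e1) = lambda * T2 (b * b').
Proof.
move=> bB b'B; apply: (mulfI l0).
rewrite -T1Z -(EM_gen hM2) -/(T2 _) -mulrA -(ractE dual1 l0 hM2) !mulrA.
rewrite -(lactE dual1 l0 hM2).
rewrite [X in T2 X](_ : _ = b * (j2 e1 * e2 * j2 e1) * b').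
  2: by rewrite !mulrA.
rewrite jones_braid -scalerAr -scalerAl {1}/trace2 linearZ T1Z.
rewrite -[RHS]mulrA; congr (_ * _).
rewrite -[LHS]/(T2 _) (T2_trace (b * _)) mulrA (T2_trace (b' * b)).
rewrite T2_j2l T1_jones_V; first by rewrite T2_trace.
by apply/EM1_B_in/rpredM.
Qed.

(** * Dual bases for the traces on V, B and A *)

Variables (s : nat) (u v : 'I_s -> B).
Hypothesis dualB :
  dual_bases j2 EM1 (fun l => val (u l)) (fun l => val (v l)).
Variables (f : seq (V * V)) (w : V) (SB : {linear B -> B})
  (Delta : A -> seq (A * A)) (S : A -> A).
Hypothesis hA :
  weak_hopf_structure i E T lambda j1 e1 EM j2 e2 EM1 f w SB Delta S.

Let winv : V := \sum_(p <- f) trace2 E T EM EM1 (j2 (val p.2)) *: p.1.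

Lemma winvE : winv = \sum_(p <- f) T1 (val p.2) *: p.1.
Proof. by apply: eq_bigr => p _; rewrite T2_j2. Qed.

Lemma separability_flip_mul : \sum_(p <- f) p.2 * p.1 = 1.
Proof.
rewrite -(sep_mul (wh_f hA)).
rewrite -(tensor_eq_sum (F := fun a b => a * b) _ _ (sep_flip (wh_f hA))).
- by rewrite big_map.
- by move=> a c b b'; rewrite mulrDr scalerAr.
- by move=> a c b b'; rewrite mulrDl scalerAl.
Qed.

(** Moving z from one leg of f to the other makes the sum w w^-1 z. *)
Lemma T1_dual_V (z : V) : \sum_(p <- f) T1 (val z * val p.2) *: (w * p.1) = z.
Proof.
have flip (L : {scalar V}) :
    \sum_(p <- f) L p.2 *: p.1 = \sum_(p <- f) L p.1 *: p.2.
  by rewrite -(tensor_eq_scale L (sep_flip (wh_f hA))) big_map.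
pose L1 (c : V) : k := T1 (val c).
have T1P c a b : T1 (c *: a + b) = c * T1 a + T1 b.
  by rewrite /trace1 /trace0 !(linearD, linearZ).
have L1l : scalar L1 by move=> c a b; rewrite /L1 -T1P.
pose L2 (c : V) : k := T1 (val z * val c).
have L2l : scalar L2.
  by move=> c a b; rewrite /L2 -T1P scalerAr -mulrDr.
pose L1s : {scalar V} := HB.pack L1 (GRing.isLinear.Build _ _ _ _ L1 L1l).
pose L2s : {scalar V} := HB.pack L2 (GRing.isLinear.Build _ _ _ _ L2 L2l).
transitivity (w * (\sum_(p <- f) L2s p.2 *: p.1)).
  by rewrite mulr_sumr; apply: eq_bigr => p _; rewrite -scalerAr.
rewrite flip.
have := tensor_eq_scale L1s (sep_comm (wh_f hA) z); rewrite !big_map /= => ->.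
transitivity (w * (\sum_(p <- f) L1s p.1 *: p.2) * z).
  rewrite -mulrA mulr_suml; congr (_ * _); apply: eq_bigr => p _.
  by rewrite scalerAl.
by rewrite -flip -[X in w * X]winvE (wh_wl hA) mul1r.
Qed.

Lemma T1_dual_V_val (z : V) :
  \sum_(p <- f) T1 (val z * val p.2) *: (val w * val p.1) = val z.
Proof. by rewrite -[in RHS](T1_dual_V z) raddf_sum. Qed.

Lemma T2_dual_B b : b \in inB ->
  \sum_l \sum_(p <- f) T2 (b * (val (u l) * j2 (val p.2))) *:
     (j2 (val w * val p.1) * val (v l)) = b.
Proof.
move=> bB; rewrite -[RHS](dualB b).1; apply: eq_bigr => l _.
have zV : EM1 (b * val (u l)) \in inV by apply/EM1_B_in/rpredM/centr_valP.
have -> : EM1 (b * val (u l)) = val (Centr zV) by [].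
rewrite -(T1_dual_V_val (Centr zV)) raddf_sum mulr_suml; apply: eq_bigr => p _.
by rewrite mulrA T2_j2r /= [j2 (_ *: _)]linearZ /= -scalerAl.
Qed.

(** With R, R' the dual bases of B, the dual bases of A are
    P = lambda^-2 E_M1 (e2 e1 R) and Q = R' . e1.  Multiplying the second
    equation by e2 on the right makes Q e2 into R' e1 e2; then m commutes with
    R', and in R w^-1 (x) R' the two copies of w cancel, leaving u_l (x) v_l,
    which recombine e2 e1.  What remains is e2 e1 m e1 e2. *)
Lemma T1_dual_A : exists D : seq (A * A),
  (forall a : A, \sum_(d <- D) T1 (val a * val d.1) *: val d.2 = val a) /\
  (forall m, lambda *: (\sum_(d <- D) val d.1 * val winv * j1 m * val d.2) =
     j1 (i (E m))).
Proof.
pose R l (p : V * V) := val (u l) * j2 (val p.2).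
pose R' l (p : V * V) := j2 (val w * val p.1) * val (v l).
have RB l p : R l p \in inB by apply/rpredM/j2V_in/centr_valP/centr_valP.
have R'B l p : R' l p \in inB.
  by apply/rpredM/centr_valP/j2V_in/rpredM; apply: centr_valP.
pose P l p : A := Centr (ract2_in (RB l p) e1_in).
pose Q l p : A := Centr (lact2_in (R'B l p) e1_in).
exists [seq (lambda^-1 *: P l p, Q l p) | l <- enum 'I_s, p <- f].
split=> [a|m].
  have [b bB ab] := lact2_surj (centr_valP a).
  rewrite big_allpairs_dep big_enum /= -[RHS]ab -[in RHS](T2_dual_B bB).
  rewrite lact_sum; apply: eq_bigr => l _.
  rewrite lact_sum; apply: eq_bigr => p _.
  rewrite lactZ -scalerAr T1Z -[in LHS]ab T1_lact_ract //.
  by rewrite mulKf.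
have winv_w : val winv * val w = 1 by have := congr1 val (wh_wr hA).
have p21 : \sum_(p <- f) val p.2 * val p.1 = 1.
  by have := congr1 val separability_flip_mul; rewrite raddf_sum.
apply: (jones_inj l0 hM2).
rewrite big_allpairs_dep big_enum /= linearZ /= -scalerAl.
have term l p :
    j2 (ract2 (R l p) e1 * val winv * j1 m * lact2 (R' l p) e1) * e2 =
    j2 (ract2 (val (u l)) e1) * j2 (val p.2 * val p.1) * val (v l) *
    (j2 (j1 m) * j2 e1 * e2).
  have /centralizerP/(_ m)/= C := R'B l p.
  rewrite rmorphM -mulrA -(lactE dual1 l0 hM2) (ract_mulj dual1 l0 hM2).
  transitivity (j2 (ract2 (val (u l)) e1 * val p.2 * val winv) *
                (j2 (j1 m) * R' l p) * (j2 e1 * e2)).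
    by rewrite !rmorphM !mulrA.
  rewrite C /R' !rmorphM !mulrA.
  rewrite -(mulrA _ (j2 (val winv)) (j2 (val w))) -(rmorphM j2 (val winv)).
  by rewrite winv_w rmorph1 mulr1.
transitivity (\sum_l j2 (ract2 (val (u l)) e1) * val (v l) *
    (j2 (j1 m) * j2 e1 * e2)).
  rewrite raddf_sum mulr_suml scaler_sumr; apply: eq_bigr => l _ /=.
  rewrite -[j2 (ract2 _ _)]mulr1 -[in RHS](rmorph1 j2) -p21 !rmorph_sum.
  rewrite mulr_sumr !mulr_suml scaler_sumr; apply: eq_bigr => p _ /=.
  rewrite -term -/(ract lambda j2 e2 EM1 _ _) -!scalerAl.
  by rewrite [j2 (_ *: _)]linearZ /= -scalerAl scalerA mulfV // scale1r.
rewrite -mulr_suml.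
have -> : \sum_l j2 (ract2 (val (u l)) e1) * val (v l) =
    lambda^-1 *: (e2 * j2 e1).
  rewrite -[in RHS](dualB (e2 * j2 e1)).1 scaler_sumr; apply: eq_bigr => l _.
  by rewrite /ract [j2 (_ *: _)]linearZ /= scalerAl.
transitivity (lambda^-1 *: (e2 * j2 (e1 * j1 m * e1) * e2)).
  by rewrite !rmorphM -!scalerAl !mulrA.
rewrite (jones_sandwich hM1) (jones_sandwich hM2) (EM_e hM1) !linearZ /=.
by rewrite -scalerAl scalerA mulVf // scale1r.
Qed.

(** * The weak Hopf algebra structure through the trace form *)

Lemma T1_nondegenerate z z' : z \in inA -> z' \in inA ->
  (forall c : A, T1 (z * val c) = T1 (z' * val c)) -> z = z'.
Proof.
move=> zA z'A zz'; have [D [D_dual _]] := T1_dual_A.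
rewrite -[z]/(val (Centr zA)) -[z']/(val (Centr z'A)).
rewrite -(D_dual (Centr zA)) -(D_dual (Centr z'A)).
by apply: eq_bigr => d _; rewrite zz'.
Qed.

Lemma pairingE (a : A) (b : B) : pairing E T lambda e1 EM e2 EM1 w a b =
  lambda^-1 * T1 (val a * ract2 (j2 (val w) * val b) e1).
Proof.
rewrite /pairing -exprVn expr2 -[LHS]mulrA; congr (_ * _).
by rewrite -!(mulrA (j2 (val a))) T2_j2l /ract -scalerAr T1Z !mulrA.
Qed.

Lemma pairing'E (a : A) (b : B) : pairing' E T lambda e1 EM e2 EM1 w a b =
  lambda^-1 * T1 (lact2 (val b) e1 * val w * val a).
Proof.
rewrite /pairing' -exprVn expr2 -[LHS]mulrA; congr (_ * _).
by rewrite -mulrA -rmorphM T2_j2r /lact -!scalerAl T1Z -!mulrA.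
Qed.

Lemma pairing_surj z : z \in inA ->
  exists b : B, ract2 (j2 (val w) * val b) e1 = z.
Proof.
move=> zA; have [c cB <-] := ract2_surj zA.
have bB : j2 (val winv) * c \in inB by apply/rpredM/cB/j2V_in/centr_valP.
exists (Centr bB); rewrite /= mulrA -rmorphM.
have -> : val w * val winv = 1 by have := congr1 val (wh_wl hA).
by rewrite rmorph1 mul1r.
Qed.

Lemma lact_SB (b : B) :
  lact2 (val (SB b)) e1 * val w = ract2 (j2 (val w) * val b) e1.
Proof.
apply: T1_nondegenerate => [||c].
- by apply/rpredM/V_sub_A/centr_valP/lact2_in/e1_in/centr_valP.
- by apply/ract2_in/e1_in/rpredM/centr_valP/j2V_in/centr_valP.
apply: (mulfI (invr_neq0 l0)).
by rewrite -pairing'E -(wh_SB hA) pairingE T1_trace.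
Qed.

(** Writing z = z_b' and c = z_b, where z_b = lambda^-1 E_M1 (e2 e1 w b), the
    left side is lambda^2 <a, b S_B(b')>, the trace of S_B(b') a e2 e1 w b.
    Here S_B(b') a e2 = X e2 with X = S_B(b') . a, which the expansion
    a = (a . x_l) e1 y_l reduces to S_B(b') . e1 = z w^-1. *)
Lemma coproduct_antipode (a : A) z : z \in inA ->
  exists2 X, X \in inA &
    X = \sum_l j1 (lact1 (val a) (x l)) * z * val winv * j1 (y l) /\
    forall c : A,
      \sum_(p <- Delta a) T1 (val p.1 * val c) * T1 (val (S p.2) * z) =
      lambda * T1 (X * val c).
Proof.
move=> zA; have [b' zb'] := pairing_surj zA.
exists (lact2 (val (SB b')) (val a)).
  by apply: lact2_in; apply: centr_valP.
split=> [|c].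
  rewrite {1}(basic_expand dual0 l0 hM1 (val a)) lact_sumr.
  apply: eq_bigr => l _; rewrite (lact_r dual1 l0 hM2) (lact_l dual1 l0 hM2).
    rewrite -zb' -lact_SB -!mulrA (mulrA (val w)).
    have -> : val w * val winv = 1 by have := congr1 val (wh_wl hA).
    by rewrite mul1r.
  by move=> m; apply: (centrC (SB b')).
have [b cb] := pairing_surj (centr_valP c).
have pb (d : A) e (b1 : B) : ract2 (j2 (val w) * val b1) e1 = e ->
    T1 (val d * e) = lambda * pairing E T lambda e1 EM e2 EM1 w d b1.
  by move=> <-; rewrite pairingE mulVKf.
under eq_bigr => p _ do
  rewrite (pb p.1 _ b cb) (pb (S p.2) _ b' zb') (wh_S hA) mulrACA.
rewrite -mulr_sumr (wh_Delta hA) /pairing -expr2 mulVKf ?expf_neq0 //=.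
rewrite mulrA T2_trace !mulrA (lactE dual1 l0 hM2) -!mulrA T2_j2l -cb /ract.
by rewrite -scalerAr T1Z mulVKf // !mulrA.
Qed.

(** Both legs of a_(1) (x) S(a_(2)) are expanded in the dual bases of A; the sum
    over the first leg reassembles X, and the sum over the second one is the
    conditional expectation of y_l m. *)
Lemma act_natural (a : A) m : act Delta S a m = j1 (lact1 (val a) m).
Proof.
have [D [D_dual casimir]] := T1_dual_A.
rewrite /act.
transitivity (\sum_(d <- D) \sum_(p <- Delta a) \sum_(d' <- D)
    (T1 (val p.1 * val d'.1) * T1 (val (S p.2) * val d.1)) *:
    (val d'.2 * j1 m * val d.2)).
  rewrite exchange_big; apply: eq_bigr => p _ /=.
  rewrite -[in LHS](D_dual (S p.2)) mulr_sumr; apply: eq_bigr => d _.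
  rewrite -[in LHS](D_dual p.1) !mulr_suml; apply: eq_bigr => d' _.
  by rewrite -scalerAr -!scalerAl scalerA; congr (_ *: _); apply: mulrC.
transitivity (\sum_(d <- D) lambda *:
    ((\sum_l j1 (lact1 (val a) (x l)) * val d.1 * val winv * j1 (y l)) *
     j1 m * val d.2)).
  apply: eq_bigr => d _.
  have [X XA [<- XE]] := coproduct_antipode a (centr_valP d.1).
  rewrite exchange_big /= -[X in X * j1 m]/(val (Centr XA)).
  rewrite -(D_dual (Centr XA)) !mulr_suml scaler_sumr; apply: eq_bigr => d' _.
  by rewrite -scaler_suml XE -!scalerAl scalerA.
transitivity (\sum_l j1 (lact1 (val a) (x l)) * j1 (i (E (y l * m)))).
  under [RHS]eq_bigr => l _ do
    rewrite -casimir -scalerAr mulr_sumr scaler_sumr.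
  rewrite exchange_big; apply: eq_bigr => d _ /=.
  rewrite !mulr_suml scaler_sumr; apply: eq_bigr => l _.
  by rewrite rmorphM !mulrA.
under eq_bigr => l _ do rewrite -rmorphM -(lact_r dual0 l0 hM1).
by rewrite -rmorph_sum -lact_sumr (dual0 m).2.
Qed.

(** The counit is a |-> <a, 1> = lambda^-1 T1 (a e1 w), so with c chosen such
    that z_c = a e1 w, the pairing of the target counit of a with b is
    <1, c b>, which is lambda^-2 times the trace of e2 a e1 w b; and
    a e1 = (a . 1) e1, where a . 1 commutes with e2. *)
Lemma target_counit_natural (a : A) :
  val (target_counit E T lambda e1 EM j2 e2 EM1 w Delta a) =
  j1 (lact1 (val a) 1).
Proof.
have uA : j1 (lact1 (val a) 1) \in inA.
  apply/centralizerP => n /=; rewrite -!rmorphM; congr (j1 _).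
  rewrite -(lact_r dual0 l0 hM1) mul1r -(lact_l dual0 l0 hM1) ?mulr1 //.
  exact: centrC.
apply: T1_nondegenerate => [||z] //; first exact: centr_valP.
have [b zb] := pairing_surj (centr_valP z).
have e1w : ract2 (j2 (val w) * 1) e1 = e1 * val w.
  by rewrite mulr1 -[j2 _]mul1r (ract_mulj dual1 l0 hM2) (ract_unit l0 hM2).
have [c zc] : exists c : B,
    ract2 (j2 (val w) * val c) e1 = val a * (e1 * val w).
  apply/pairing_surj/rpredM/rpredM/V_sub_A/centr_valP/e1_in.
  exact: centr_valP.
rewrite raddf_sum mulr_suml T1_sum.
transitivity (\sum_(p <- Delta 1) lambda *
    (pairing E T lambda e1 EM e2 EM1 w p.1 c *
     pairing E T lambda e1 EM e2 EM1 w p.2 b)).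
  apply: eq_bigr => p _ /=.
  rewrite -scalerAl T1Z /counit !pairingE e1w zc zb.
  have -> : val (p.1 * a) = val p.1 * val a by [].
  by rewrite -!mulrA mulVKf // mulrCA.
rewrite -mulr_sumr (wh_Delta hA) /pairing -exprVn expr2.
rewrite -[lambda^-1 * _ * T2 _]mulrA mulVKf //.
have ae1 : val a * (e1 * val w) = j1 (lact1 (val a) 1) * (e1 * val w).
  by rewrite !mulrA -(lactE dual0 l0 hM1) rmorph1 mulr1.
rewrite [X in T2 X](_ : _ = j2 (j1 (lact1 (val a) 1)) *
    (e2 * j2 e1 * (j2 (val w) * val b))).
  by rewrite T2_j2l /= -zb /ract -scalerAr T1Z.
transitivity (e2 * j2 e1 * (j2 (val w) * val c) * val b).
  by rewrite -!mulrA /= rmorph1 mul1r.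
by rewrite (ractE dual1 l0 hM2) zc ae1 !rmorphM !mulrA e2C.
Qed.

End JonesTower.

(** * Invariants *)

Theorem proposition4p7 (k : fieldType) (N M M1 M2 : algType k)
  (i : {lrmorphism N -> M}) (E : {linear M -> N}) (T : {scalar N})
  (lambda : k) (r : nat) (x y : 'I_r -> M)
  (j1 : {lrmorphism M -> M1}) (e1 : M1) (EM : {linear M1 -> M})
  (j2 : {lrmorphism M1 -> M2}) (e2 : M2) (EM1 : {linear M2 -> M1})
  (hMarkov : symmetric_markov i E x y lambda T)
  (hM1 : basic_construction i E lambda j1 e1 EM)
  (hM2 : basic_construction j1 EM lambda j2 e2 EM1)
  (hSym : symmetric_product i E T lambda x y j1 e1 EM)
  (hIrr : weakly_irreducible i E T)
  (hDepth : depth2 i j1 EM j2 EM1)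
  (f : seq (centr j1 * centr j1)) (w : centr j1)
  (SB : {linear centr (j2 \o j1) -> centr (j2 \o j1)})
  (Delta : centr (j1 \o i) -> seq (centr (j1 \o i) * centr (j1 \o i)))
  (S : centr (j1 \o i) -> centr (j1 \o i))
  (hA : weak_hopf_structure i E T lambda j1 e1 EM j2 e2 EM1 f w SB Delta S) :
  range i = invariants i E T lambda j1 e1 EM j2 e2 EM1 w Delta S.
Proof.
have [_ [s [u [v dualB]]]] := hDepth.
have dual0 := frobenius_dual_bases hMarkov; have l0 := strong_lambda hMarkov.
have natE := act_natural hMarkov hM1 hM2 hSym dualB hA.
have countE := target_counit_natural hMarkov hM1 hM2 hSym dualB hA.
have invE a m :
    act Delta S (target_counit E T lambda e1 EM j2 e2 EM1 w Delta a) m =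
    j1 (lact lambda j1 e1 EM (val a) 1 * m).
  rewrite natE countE -[j1 (lact _ _ _ _ _ 1)]mulr1.
  by rewrite (lact_jmul dual0 l0 hM1) (lact_unit l0 hM1).
apply/seteqP; split=> [_ [n _ <-] a|m m_inv].
  by rewrite natE invE -(lact_r dual0 l0 hM1) mul1r.
have := m_inv (Centr (e1_in hM1)).
rewrite natE invE /= !(lact_e l0 hM1) (strong_E1 hMarkov) rmorph1 mul1r.
by move=> /(can_inj (EM_j1 hMarkov hM1)) <-; exists (E m).
Qed.
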